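(* Let $1>x>0$, then $\models^{\langle x,1\rangle^\uparrow}_{\mathsf{G}^2_{(\rightarrow,-\!<)}}$, $\models^{\langle x^\circ,1^\bullet\rangle^\uparrow}_{\mathsf{G}^2_{(\rightarrow,-\!<)}}$, and $\models^\leq_{\mathsf{G}^2_{(\rightarrow,-\!<)}}$ coincide.
   Context: $\mathsf{G}^2_{(\rightarrow,-\!<)}$: formulas built from variables with $\neg$, ${\sim},\triangle,\wedge,\vee,\rightarrow$ and co-implication $-\!<$. Write $a\rightarrow_{\mathsf{G}} b=1$ if $a\leq b$ else $b$, and $a-\!<_{\mathsf{G}} b=0$ if $a\leq b$ else $a$. A valuation is a pair $v=\langle v_1,v_2\rangle$ of maps from variables to $[0,1]$ extended by: $v_1(\neg\phi)=v_2(\phi)$, $v_2(\neg\phi)=v_1(\phi)$; $v_1(\triangle\phi)=1$ iff $v_1(\phi)=1$ (else $0$), $v_2(\triangle\phi)=1$ iff $v_2(\phi)>0$ (else $0$); $v_1({\sim}\phi)=1$ iff $v_1(\phi)=0$ (else $0$), $v_2({\sim}\phi)=1-\!<_{\mathsf{G}}v_2(\phi)$; $v_1(\wedge)=\min$, $v_2(\wedge)=\max$; $v_1(\vee)=\max$, $v_2(\vee)=\min$; $v_1(\phi\rightarrow\chi)=v_1(\phi)\rightarrow_{\mathsf{G}}v_1(\chi)$, $v_2(\phi\rightarrow\chi)=v_2(\chi)-\!<_{\mathsf{G}}v_2(\phi)$; $v_1(\phi-\!<\chi)=v_1(\phi)-\!<_{\mathsf{G}}v_1(\chi)$, $v_2(\phi-\!<\chi)=v_2(\chi)\rightarrow_{\mathsf{G}}v_2(\phi)$.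 $\langle x,y\rangle^\uparrow=\{\langle x',y'\rangle\mid x'\geq x,\,y'\leq y\}$ and $\langle x^\circ,y^\bullet\rangle^\uparrow=\langle x,y\rangle^\uparrow\setminus\{\langle x',y'\rangle\mid x'=x\}$. With $v[\Gamma]=\langle\inf_{\phi\in\Gamma}v_1(\phi),\sup_{\phi\in\Gamma}v_2(\phi)\rangle$, $\Gamma\models^\mathcal{D}\chi$ iff for every $v$, $v[\Gamma]\in\mathcal{D}$ implies $v(\chi)\in\mathcal{D}$. $\Gamma\models^\leq\chi$ iff for every $v$, $\inf_{\phi\in\Gamma}v_1(\phi)\leq v_1(\chi)$ and $\sup_{\phi\in\Gamma}v_2(\phi)\geq v_2(\chi)$. *)

(* Defs.v *)
From mathcomp Require Import all_boot all_order all_algebra.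
From mathcomp Require Import all_classical all_reals.
Set Implicit Arguments.
Unset Strict Implicit.
Unset Printing Implicit Defensive.
Import Order.TTheory GRing.Theory Num.Theory.
Local Open Scope classical_set_scope.
Local Open Scope ring_scope.

Inductive formula (V : Type) : Type :=
| Var of V
| Neg of formula V                 (* De Morgan negation, exchanging v1, v2 *)
| GNeg of formula V                (* Goedel negation ~ *)
| Delta of formula V
| And of formula V & formula V
| Or of formula V & formula V
| Imp of formula V & formula V
| CoImp of formula V & formula V.

Record valuation (V : Type) (R : realType) : Type := Valuation {
  v1 : V -> R;
  v2 : V -> R;
  v1_01 : forall p, 0 <= v1 p <= 1;
  v2_01 : forall p, 0 <= v2 p <= 1
}.

Section Semantics.
Variables (V : Type) (R : realType).
Implicit Types (a b x y : R) (v : valuation V R) (phi chi : formula V).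
Implicit Types (Gamma : set (formula V)) (D : set (R * R)).

Definition gimp a b : R := if a <= b then 1 else b.

Definition gcoimp a b : R := if a <= b then 0 else a.

(* The two components are computed together because Neg exchanges them. *)
Fixpoint eval v phi : R * R :=
  match phi with
  | Var p => (v1 v p, v2 v p)
  | Neg f => ((eval v f).2, (eval v f).1)
  | GNeg f => (if (eval v f).1 == 0 then 1 else 0, gcoimp 1 (eval v f).2)
  | Delta f => (if (eval v f).1 == 1 then 1 else 0,
                if 0 < (eval v f).2 then 1 else 0)
  | And f g => (Num.min (eval v f).1 (eval v g).1,
                Num.max (eval v f).2 (eval v g).2)
  | Or f g => (Num.max (eval v f).1 (eval v g).1,
               Num.min (eval v f).2 (eval v g).2)
  | Imp f g => (gimp (eval v f).1 (eval v g).1,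
                gcoimp (eval v g).2 (eval v f).2)
  | CoImp f g => (gcoimp (eval v f).1 (eval v g).1,
                  gimp (eval v g).2 (eval v f).2)
  end.

(* Infimum and supremum in the complete lattice [0, 1]: for A included in
   [0, 1], adding the top (bottom) element only matters when A is empty, where
   it yields inf = 1 and sup = 0 (in R, [inf set0] would be 0). *)
Definition inf01 (A : set R) : R := inf (1 |` A).
Definition sup01 (A : set R) : R := sup (0 |` A).

Definition eval_set v Gamma : R * R :=
  (inf01 [set (eval v phi).1 | phi in Gamma],
   sup01 [set (eval v phi).2 | phi in Gamma]).

Definition up x y : set (R * R) :=
  [set p | 0 <= p.1 <= 1 /\ 0 <= p.2 <= 1] `&` [set p | x <= p.1 /\ p.2 <= y].

(* Open in the first coordinate only: the second bound y is retained. *)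
Definition up_open x y : set (R * R) := up x y `\` [set p | p.1 = x].

Definition entails_filter D Gamma chi : Prop :=
  forall v, D (eval_set v Gamma) -> D (eval v chi).

Definition entails_le Gamma chi : Prop :=
  forall v, (eval_set v Gamma).1 <= (eval v chi).1 /\
            (eval v chi).2 <= (eval_set v Gamma).2.

End Semantics.

Arguments entails_filter {V R} D Gamma chi.
Arguments entails_le {V} R Gamma chi.

(* Main.v *)
Require Import Defs.
From mathcomp Require Import all_boot all_order all_algebra.
From mathcomp Require Import all_classical all_reals.
From mathcomp Require Import lra.
Set Implicit Arguments.
Unset Strict Implicit.
Unset Printing Implicit Defensive.
Import Order.TTheory GRing.Theory Num.Theory.
Local Open Scope classical_set_scope.
Local Open Scope ring_scope.

(** With second bound 1 both filters only constrain the first coordinate, so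
    each of them is implied by the order entailment.  Conversely, strictly
    increasing maps of [0, 1] fixing 0 and 1 commute with evaluation; if v1 is
    at least i on Gamma but below i at chi, such a map moves a point between
    v1(chi) and i to x and yields a counterexample for both filters.  A failure
    of the order entailment in the second coordinate is turned into one in the
    first by the valuation p |-> (1 - v2 p, 1 - v1 p). *)

Lemma eval_01 (V : Type) (R : realType) (v : valuation V R) (phi : formula V) :
  0 <= (eval v phi).1 <= 1 /\ 0 <= (eval v phi).2 <= 1.
Proof.
have bool01 (b : bool) : 0 <= (if b then 1 else 0 : R) <= 1.
  by case: b; rewrite ?lexx ?ler01.
have gimp01 (a b : R) : 0 <= b <= 1 -> 0 <= gimp a b <= 1.
  by rewrite /gimp; case: ifP => // _ _; rewrite lexx ler01.
have gcoimp01 (a b : R) : 0 <= a <= 1 -> 0 <= gcoimp a b <= 1.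
  by rewrite /gcoimp; case: ifP => // _ _; rewrite lexx ler01.
have min01 (a b : R) : 0 <= a <= 1 -> 0 <= b <= 1 -> 0 <= Num.min a b <= 1.
  by rewrite minEle; case: ifP.
have max01 (a b : R) : 0 <= a <= 1 -> 0 <= b <= 1 -> 0 <= Num.max a b <= 1.
  by rewrite maxEle; case: ifP.
elim: phi => [p|f [f1 f2]|f [f1 f2]|f [f1 f2]|f [f1 f2] g [g1 g2]
  |f [f1 f2] g [g1 g2]|f [f1 f2] g [g1 g2]|f [f1 f2] g [g1 g2]] //=; split; auto.
- exact: v1_01.
- exact: v2_01.
- by apply: gcoimp01; rewrite lexx ler01.
Qed.

Section Inf01Sup01.
Variable R : realType.
Implicit Types (A : set R) (a b : R).

(** The adjoined [1] keeps the set nonempty, so an empty [A] is no special case; [b <= 1] says that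
    [b] also bounds this extra point. *)
Lemma le_inf01 A b : b <= 1 -> (forall a, A a -> b <= a) -> b <= inf01 A.
Proof.
move=> b1 bA; apply: lb_le_inf; first by exists 1; left.
by move=> a [->|/bA].
Qed.

Lemma inf01_le1 A : (forall a, A a -> 0 <= a) -> inf01 A <= 1.
Proof.
move=> A0; apply: ge_inf; last by left.
by exists 0 => a [->|/A0]; rewrite ?ler01.
Qed.

Lemma inf01_le A a : (forall a', A a' -> 0 <= a') -> A a -> inf01 A <= a.
Proof.
move=> A0 Aa; apply: ge_inf; last by right.
by exists 0 => a' [->|/A0]; rewrite ?ler01.
Qed.

Lemma sup01_ge0 A : (forall a, A a -> a <= 1) -> 0 <= sup01 A.
Proof.
move=> A1; apply: ub_le_sup; last by left.
by exists 1 => a [->|/A1]; rewrite ?ler01.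
Qed.

Lemma le_sup01 A a : (forall a', A a' -> a' <= 1) -> A a -> a <= sup01 A.
Proof.
move=> A1 Aa; apply: ub_le_sup; last by right.
by exists 1 => a' [->|/A1]; rewrite ?ler01.
Qed.

Lemma sup01_le A b : 0 <= b -> (forall a, A a -> a <= b) -> sup01 A <= b.
Proof.
move=> b0 bA; apply: ge_sup; first by exists 0; left.
by move=> a [->|/bA].
Qed.

End Inf01Sup01.

Section Increasing.
Variables (V : Type) (R : realType) (h : R -> R).
Hypotheses (h0 : h 0 = 0) (h1 : h 1 = 1) (hle : {mono h : a b / a <= b}).

Lemma mono_01 (a : R) : 0 <= a <= 1 -> 0 <= h a <= 1.
Proof. by rewrite -{2}h0 -{2}h1 !hle. Qed.

Definition map_valuation (v : valuation V R) : valuation V R :=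
  Valuation (fun p => mono_01 (v1_01 v p)) (fun p => mono_01 (v2_01 v p)).

(** Every connective is computed from the order and the constants 0 and 1 alone, all of which [h]
    preserves and reflects. *)
Lemma eval_map (v : valuation V R) (phi : formula V) :
  eval (map_valuation v) phi = (h (eval v phi).1, h (eval v phi).2).
Proof.
have eq0 a : (h a == 0) = (a == 0) by rewrite !eq_le -{1 2}h0 !hle.
have eq1 a : (h a == 1) = (a == 1) by rewrite !eq_le -{1 2}h1 !hle.
have gt0 a : (0 < h a) = (0 < a) by rewrite !ltNge -{1}h0 hle.
have hgimp a b : gimp (h a) (h b) = h (gimp a b).
  by rewrite /gimp hle; case: ifP; rewrite ?h1.
have hgcoimp a b : gcoimp (h a) (h b) = h (gcoimp a b).
  by rewrite /gcoimp hle; case: ifP; rewrite ?h0.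
have hmin a b : Num.min (h a) (h b) = h (Num.min a b).
  by rewrite !minEle hle; case: ifP.
have hmax a b : Num.max (h a) (h b) = h (Num.max a b).
  by rewrite !maxEle hle; case: ifP.
elim: phi => [p|f IHf|f IHf|f IHf|f IHf g IHg|f IHf g IHg|f IHf g IHg
  |f IHf g IHg] //=; rewrite ?IHf ?IHg //=
  ?hmin ?hmax ?hgimp ?hgcoimp //.
(* Reading the first argument of [gcoimp 1 _] as [h 1] brings [GNeg] under [hgcoimp]. *)
- by rewrite eq0 -{2}h1 hgcoimp; case: ifP; rewrite ?h0 ?h1.
- by rewrite eq1 gt0; do 2!case: ifP; rewrite ?h0 ?h1.
Qed.

End Increasing.

Section Duality.
Variables (V : Type) (R : realType) (v : valuation V R).

Lemma onem_01 (a : R) : 0 <= a <= 1 -> 0 <= 1 - a <= 1.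
Proof. by move=> /andP[? ?]; apply/andP; split; lra. Qed.

Definition dual_valuation : valuation V R :=
  Valuation (fun p => onem_01 (v2_01 v p)) (fun p => onem_01 (v1_01 v p)).

(** The map [a |-> 1 - a] reverses the order, hence swaps [min] with [max] and [gimp] with [gcoimp]
    (arguments flipped); exchanging the coordinates undoes the swap. *)
Lemma eval_dual (phi : formula V) :
  eval dual_valuation phi = (1 - (eval v phi).2, 1 - (eval v phi).1).
Proof.
have le1B (a b : R) : (1 - a <= 1 - b) = (b <= a) by apply/idP/idP; lra.
have hgimp (a b : R) : gimp (1 - a) (1 - b) = 1 - gcoimp b a.
  by rewrite /gimp /gcoimp le1B; case: ifP; rewrite ?subr0.
have hgcoimp (a b : R) : gcoimp (1 - a) (1 - b) = 1 - gimp b a.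
  by rewrite /gimp /gcoimp le1B; case: ifP; rewrite ?subrr.
have hmin (a b : R) : Num.min (1 - a) (1 - b) = 1 - Num.max a b.
  by rewrite minEle maxEge le1B; case: ifP.
have hmax (a b : R) : Num.max (1 - a) (1 - b) = 1 - Num.min a b.
  by rewrite maxEle minEge le1B; case: ifP.
elim: phi => [p|f IHf|f IHf|f IHf|f IHf g IHg|f IHf g IHg|f IHf g IHg
  |f IHf g IHg] //=; rewrite ?IHf ?IHg //=
  ?hmin ?hmax ?hgimp ?hgcoimp //.
(* [GNeg] and [Delta] remain. They test an equality with 0 or 1 in one coordinate and an inequality
   in the other; these tests match only for values in [0, 1]. *)
all: have [/andP[? ?] /andP[? ?]] := eval_01 v f.
- rewrite /gcoimp; congr pair.
    case: eqP; case: leP => *; lra.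
  case: eqP; case: leP => *; lra.
- congr pair.
    case: eqP; case: ltP => *; lra.
  case: eqP; case: ltP => *; lra.
Qed.

End Duality.

Lemma increasing_through (R : realType) (t x : R) : 0 < t < 1 -> 0 < x < 1 ->
  exists h : R -> R,
    [/\ h 0 = 0, h 1 = 1, h t = x & {mono h : a b / a <= b}].
Proof.
move=> /andP[t0 t1] /andP[x0 x1].
have t1' : 0 < 1 - t by rewrite subr_gt0.
have c0 : 0 < x / t by rewrite divr_gt0.
have d0 : 0 < (1 - x) / (1 - t) by rewrite divr_gt0 ?subr_gt0.
(* Piecewise linear with its break at [(t, x)]: the slopes are those of the segments from [(0, 0)]
   and to [(1, 1)]. *)
exists (fun s => x + (if s <= t then x / t else (1 - x) / (1 - t)) * (s - t)).
split.
- by rewrite (ltW t0) sub0r mulrN divfK ?gt_eqF // subrr.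
- by rewrite leNgt t1 /= divfK ?gt_eqF //; lra.
- by rewrite subrr mulr0 addr0.
- apply: le_mono => a b ab.
  have [bt|tb] := leP b t.
    by rewrite (ltW (lt_le_trans ab bt)) ltrD2l ltr_pM2l // ltrD2r.
  have [at_|ta] := leP a t; last by rewrite ltrD2l ltr_pM2l // ltrD2r.
  (* Here [a <= t < b], so the two increments from [x] are separated by 0. *)
  rewrite ltrD2l; apply: (@le_lt_trans _ _ 0).
    by rewrite pmulr_rle0 // subr_le0.
  by rewrite mulr_gt0 // subr_gt0.
Qed.

Lemma up1E (V : Type) (R : realType) (v : valuation V R) (x : R)
    (phi : formula V) : up x 1 (eval v phi) <-> x <= (eval v phi).1.
Proof.
have [? v2_01] := eval_01 v phi; split=> [[_ []]//|xle].
by split; split=> //; case/andP: v2_01.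
Qed.

Section EvalSet.
Variables (V : Type) (R : realType).
Implicit Types (v : valuation V R) (Gamma : set (formula V)).

Lemma eval_set1_le v Gamma phi :
  Gamma phi -> (eval_set v Gamma).1 <= (eval v phi).1.
Proof.
move=> Gphi; apply: inf01_le; last by exists phi.
by move=> _ [psi _ <-]; case: (eval_01 v psi) => /andP[].
Qed.

Lemma le_eval_set2 v Gamma phi :
  Gamma phi -> (eval v phi).2 <= (eval_set v Gamma).2.
Proof.
move=> Gphi; apply: le_sup01; last by exists phi.
by move=> _ [psi _ <-]; case: (eval_01 v psi) => _ /andP[].
Qed.

Lemma eval_set_01 v Gamma :
  0 <= (eval_set v Gamma).1 <= 1 /\ 0 <= (eval_set v Gamma).2 <= 1.
Proof.
split; apply/andP; split.
- apply: le_inf01 => // _ [psi _ <-].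
  by case: (eval_01 v psi) => /andP[].
- apply: inf01_le1 => _ [psi _ <-].
  by case: (eval_01 v psi) => /andP[].
- apply: sup01_ge0 => _ [psi _ <-].
  by case: (eval_01 v psi) => _ /andP[].
- apply: sup01_le => // _ [psi _ <-].
  by case: (eval_01 v psi) => _ /andP[].
Qed.

(** Only a lower bound [i] is required, so [h] need not commute with infima: [h i] bounds the new
    values from below and already exceeds [x]. *)
Lemma shift_counterexample v Gamma chi (i x : R) : 0 < x < 1 -> i <= 1 ->
  (forall phi, Gamma phi -> i <= (eval v phi).1) -> (eval v chi).1 < i ->
  exists w : valuation V R, up_open x 1 (eval_set w Gamma) /\
    (eval w chi).1 < x.
Proof.
move=> hx i1 iG chii; have [/andP[chi0 _] _] := eval_01 v chi.
(* The midpoint is strict on both sides: [chi] lands below [x], and [i] lands above [x], as the open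
   filter demands. *)
pose t := ((eval v chi).1 + i) / 2.
have chit : (eval v chi).1 < t by rewrite /t; lra.
have ti : t < i by rewrite /t; lra.
have t01 : 0 < t < 1 by apply/andP; split; lra.
have [h [h0 h1 htx hle]] := increasing_through t01 hx.
pose w := map_valuation h0 h1 hle v.
exists w; split; last by rewrite eval_map /= -htx (leW_mono hle).
have xi : x < (eval_set w Gamma).1.
  apply: (@lt_le_trans _ _ (h i)); first by rewrite -htx (leW_mono hle).
  apply: le_inf01; first by rewrite -h1 hle.
  by move=> _ [phi /iG iphi <-]; rewrite eval_map /= hle.
have [s1 s2] := eval_set_01 w Gamma.
split; last by move/esym=> xE; move/lt_eqF/eqP: xi => /(_ xE).
by split; split=> //; [exact: ltW | case/andP: s2].
Qed.

(** The premise takes the smaller filter as assumption and the weaker bound as conclusion, so it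
    follows from either filter entailment. *)
Lemma entails_le_of_transfer Gamma chi (x : R) : 0 < x < 1 ->
  (forall w : valuation V R, up_open x 1 (eval_set w Gamma) ->
    x <= (eval w chi).1) -> entails_le R Gamma chi.
Proof.
move=> hx Gchi v.
have [/andP[_ i1] /andP[s0 _]] := eval_set_01 v Gamma.
have no_gap (u : valuation V R) i : i <= 1 ->
    (forall phi, Gamma phi -> i <= (eval u phi).1) -> i <= (eval u chi).1.
  move=> i_le1 iG; rewrite leNgt; apply/negP => chii.
  have [w [/Gchi xle]] := shift_counterexample hx i_le1 iG chii.
  by rewrite ltNge xle.
split; first by apply: no_gap => // phi; exact: eval_set1_le.
have dualE phi : (eval (dual_valuation v) phi).1 = 1 - (eval v phi).2.
  by rewrite eval_dual.
(* One minus the supremum is a lower bound of the dual first coordinates on [Gamma]. *)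
have := no_gap (dual_valuation v) (1 - (eval_set v Gamma).2).
rewrite dualE lerD2l lerN2; apply; first by lra.
by move=> phi Gphi; rewrite dualE lerD2l lerN2; exact: le_eval_set2.
Qed.

End EvalSet.

Theorem theorem11 (V : Type) (R : realType) (x : R) (hx : 0 < x < 1)
    (Gamma : set (formula V)) (chi : formula V) :
  (entails_filter (up x 1) Gamma chi <-> entails_filter (up_open x 1) Gamma chi)
  /\ (entails_filter (up_open x 1) Gamma chi <-> entails_le R Gamma chi).
Proof.
have up_le : entails_filter (up x 1) Gamma chi -> entails_le R Gamma chi.
  move=> Gchi; apply: (entails_le_of_transfer hx) => w [wG _].
  by apply/up1E; exact: Gchi.
have open_le : entails_filter (up_open x 1) Gamma chi -> entails_le R Gamma chi.
  move=> Gchi; apply: (entails_le_of_transfer hx) => w wG.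
  by apply/up1E; have [] := Gchi w wG.
have le_up : entails_le R Gamma chi -> entails_filter (up x 1) Gamma chi.
  move=> le v [_ [xle _]]; apply/up1E; have [le1 _] := le v.
  exact: le_trans xle le1.
have le_open : entails_le R Gamma chi -> entails_filter (up_open x 1) Gamma chi.
  move=> le v [vG vGx]; split; first exact: le_up.
  (* If [chi] had first coordinate exactly [x], the infimum over [Gamma] would be both at most and
     at least [x], which the open filter excludes. *)
  move=> /= chix; apply: vGx => /=; apply/le_anti/andP; split.
    by rewrite -chix; case: (le v).
  by case: vG => _ [].
by split; split; auto.
Qed.
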